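(* Let $\lambda$ be a partition of $n$ and set $m=\gcd(\lambda)$, the greatest common divisor of the parts of $\lambda$. For any $d\in k^\times$, define the $n\times n$ matrix $D(d)=\mathrm{diag}(1,1,\ldots,1,d)$. (1) For each $d\in k^\times$, the matrix $J_\lambda D(d)$ represents a $k$-rational orbit in $\mathcal{O}_\lambda(k)$ (i.e. an $\mathrm{SL}_n(k)$-orbit contained in $\mathcal{O}_\lambda(k)$), and conversely every $\mathrm{SL}_n(k)$-orbit in $\mathcal{O}_\lambda(k)$ has a representative of this form. (2) For partitions $\lambda,\lambda'$ of $n$ and $d,d'\in k^\times$, the $\mathrm{SL}_n(k)$-orbits represented by $J_\lambda D(d)$ and $J_{\lambda'}D(d')$ coincide if and only if $\lambda=\lambda'$ and $d\equiv d'$ in $k^\times/(k^\times)^m$. Thus there are exactly $|k^\times/(k^\times)^m|$ rational orbits of $\mathrm{SL}_n(k)$ in $\mathcal{O}_\lambda(k)$.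
   Context: $k$ is a non-Archimedean local field of characteristic $0$ or of characteristic $p>3(n-1)$, $K$ is an algebraic closure of $k$, and $n\ge2$. A partition $\lambda$ of $n$ is a weakly decreasing sequence of positive integers with sum $n$. $J_\lambda$ is the $n\times n$ upper triangular nilpotent matrix in Jordan normal form with Jordan blocks of sizes the parts of $\lambda$, in decreasing order along the diagonal (ones on the superdiagonal within each block). $\mathcal{O}_\lambda$ is the adjoint $\mathrm{SL}_n(K)$-orbit of $J_\lambda$ in $\mathfrak{sl}_n(K)$, and $\mathcal{O}_\lambda(k)=\mathcal{O}_\lambda\cap\mathfrak{sl}_n(k)$, on which $\mathrm{SL}_n(k)$ acts by conjugation. *)

(* Defs.v *)
From HB Require Import structures.
From mathcomp Require Import all_boot all_order all_algebra.
From mathcomp Require Import boolp classical_sets functions cardinality.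

Set Implicit Arguments.
Unset Strict Implicit.
Unset Printing Implicit Defensive.

Import Order.TTheory GRing.Theory Num.Theory.

Local Open Scope classical_set_scope.
Local Open Scope ring_scope.

(* A non-Archimedean local field is a field that is complete with respect to
   a normalised discrete valuation with finite residue field.  The valuation
   is a function v : k -> int whose value at 0 is irrelevant;
   [val_ge v N x] says v(x) >= N with the convention v(0) = +oo. *)
Section LocalField.
Variables (k : fieldType) (v : k -> int).

Definition val_ge (N : int) (x : k) : Prop := x = 0 \/ N <= v x.

Definition discrete_valuation : Prop :=
  [/\ forall x y, x != 0 -> y != 0 -> v (x * y) = v x + v y,
      forall x y, x != 0 -> y != 0 -> x + y != 0 ->
        Num.min (v x) (v y) <= v (x + y)
    & exists2 x, x != 0 & v x = 1].

Definition val_cauchy (u : nat -> k) : Prop :=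
  forall N : int, exists M : nat, forall i j : nat,
    (M <= i)%N -> (M <= j)%N -> val_ge N (u i - u j).

Definition val_converges (u : nat -> k) (l : k) : Prop :=
  forall N : int, exists M : nat, forall i : nat,
    (M <= i)%N -> val_ge N (u i - l).

Definition val_complete : Prop :=
  forall u, val_cauchy u -> exists l, val_converges u l.

(* The cosets x + m, for x in the valuation ring and m its maximal ideal. *)
Definition residue_field_set : set (set k) :=
  [set C | exists2 x, val_ge 0 x & C = [set y | val_ge 1 (y - x)]].

End LocalField.

Definition nonarchimedean_local_field (k : fieldType) : Prop :=
  exists v : k -> int,
    [/\ discrete_valuation v, val_complete v
      & finite_set (residue_field_set v)].

Definition is_algebraic_closure (k : fieldType) (K : closedFieldType)
    (iota : {rmorphism k -> K}) : Prop :=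
  forall z : K, algebraicOver iota z.

Definition is_partition (n : nat) (lam : seq nat) : bool :=
  [&& sorted geq lam, all (leq 1) lam & sumn lam == n].

Definition part_gcd (lam : seq nat) : nat := (\big[gcdn/0]_(a <- lam) a)%N.

(* For a partition lam of n and i < n, [reshape_index lam i] is the index of
   the diagonal block of sizes lam containing row i. *)
Definition Jmx (F : fieldType) (n : nat) (lam : seq nat) : 'M[F]_n :=
  \matrix_(i < n, j < n)
    ((j == i.+1 :> nat) && (reshape_index lam i == reshape_index lam j))%:R.

Definition Dmx (F : fieldType) (n : nat) (d : F) : 'M[F]_n :=
  diag_mx (\row_(i < n) (if i.+1 == n then d else 1)).

Arguments Jmx : clear implicits.
Arguments Dmx : clear implicits.

Definition SL (F : fieldType) (n : nat) : set 'M[F]_n := [set g | \det g = 1].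

Definition sl (F : fieldType) (n : nat) : set 'M[F]_n := [set X | \tr X = 0].

Arguments SL : clear implicits.
Arguments sl : clear implicits.

Definition SLorbit (F : fieldType) (n : nat) (X : 'M[F]_n) : set 'M[F]_n :=
  [set Y | exists2 g, SL F n g & Y = g *m X *m invmx g].

Definition nilp_orbit (K : fieldType) (n : nat) (lam : seq nat) : set 'M[K]_n :=
  SLorbit (Jmx K n lam).

Arguments nilp_orbit : clear implicits.

Definition nilp_orbit_pts (k K : fieldType) (iota : {rmorphism k -> K})
    (n : nat) (lam : seq nat) : set 'M[k]_n :=
  [set X | sl k n X /\ nilp_orbit K n lam (map_mx iota X)].

Arguments nilp_orbit_pts {k K} iota n lam.

Definition rational_orbits (k K : fieldType) (iota : {rmorphism k -> K})
    (n : nat) (lam : seq nat) : set (set 'M[k]_n) :=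
  [set Om | (exists2 X, sl k n X & Om = SLorbit X)
            /\ Om `<=` nilp_orbit_pts iota n lam].

Arguments rational_orbits {k K} iota n lam.

(* The class of d (nonzero) in k^* / (k^* )^m, as a coset. *)
Definition power_class (k : fieldType) (m : nat) (d : k) : set k :=
  [set e | exists2 c, c != 0 & e = d * c ^+ m].

Arguments power_class {k} m d.

Definition power_quotient (k : fieldType) (m : nat) : set (set k) :=
  [set C | exists2 d, d != 0 & C = power_class m d].

Arguments power_quotient : clear implicits.

(* Main.v *)
Require Import Defs.
From HB Require Import structures.
From mathcomp Require Import all_boot all_order all_algebra all_fingroup.
From mathcomp Require Import boolp classical_sets functions cardinality.
From mathcomp Require Import zify.

Import Order.TTheory GRing.Theory Num.Theory.

Local Open Scope classical_set_scope.
Local Open Scope card_scope.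
Local Open Scope ring_scope.

Set Implicit Arguments.
Unset Strict Implicit.
Unset Printing Implicit Defensive.

(** Orbits are governed by determinants. Since the last row of [J = Jmx lam]
is zero, [D(d) J = J], so [J D(d)] is the conjugate of [J] by [D(d)^-1], and its
SL-orbit is the set of the [h J h^-1] with [\det h = d^-1] ([SLorbit_JDP]).
Two classes [d] and [e] therefore give the same orbit iff [d / e] is the
determinant of a matrix commuting with [J], and everything follows from a
computation of these determinants and from a descent from [K] to [k].

- Determinants of the centralizer. The offset of a row in its Jordan block
  grades the rows, and a matrix [Z] commuting with [J] is triangular for that
  grading and constant along the diagonals inside each pair of blocks
  ([intertwiner_triangular], [intertwiner_toeplitz]). Hence [\det Z] is the
  determinant of the degree 0 part of [Z] ([det_graded]). If [m] divides all
  the parts, every Jordan block is cut into segments of [m] consecutive rows,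
  and the degree 0 part only sees the pair of segments in which an entry lies,
  not the position inside them: it is a Kronecker product of some [b] with the
  identity of size [m], and [\det Z = \det b ^ m] ([det_centralizer_is_power]).
  Conversely scalars on the Jordan blocks commute with [J], and by Bezout their
  determinants reach every [c ^ part_gcd lam] ([exists_centralizer_det]).

- The partition is determined by the orbit. If [Z] is invertible and
  intertwines two Jordan matrices, some term of the expansion of [\det Z] is
  nonzero; it provides a permutation along which offsets cannot decrease. The
  same holds for the inverse of [Z], so the two families of offsets coincide,
  and they determine the partitions ([Jmx_twine_inj]).

- Descent. The matrices [h] with [X h = h J] form a linear space defined over
  [k]; since [k] is infinite, as the powers of a uniformizer show, an invertible
  solution over [K] yields one over [k] ([intertwiner_descent]). So each
  [k]-point of the nilpotent orbit is conjugate to [J] under GL over [k], and the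
  determinant of the conjugating matrix gives [d] ([nilp_orbit_pts_JD]). In the
  other direction, over [K] the determinant can be corrected by a scalar matrix
  because [K] has all n-th roots ([SLorbit_JD_sub]). *)

(** * Offsets inside the blocks of a partition *)

Lemma reshape_index_cons (a : nat) (lam : seq nat) (i : nat) :
  reshape_index (a :: lam) i =
  if (i < a)%N then 0%N else (reshape_index lam (i - a)).+1.
Proof.
rewrite /reshape_index /= subn_eq0.
by case: ltnP => // le_ai; rewrite subSn.
Qed.

Lemma reshape_offset_cons (a : nat) (lam : seq nat) (i : nat) :
  reshape_offset (a :: lam) i =
  if (i < a)%N then i else reshape_offset lam (i - a).
Proof.
rewrite /reshape_offset reshape_index_cons.
by case: ltnP => //= _; rewrite ?subn0 // subnDA.
Qed.

Lemma reshape_offset0 (lam : seq nat) : reshape_offset lam 0 = 0%N.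
Proof. by rewrite /reshape_offset sub0n. Qed.

Lemma reshape_offsetS (lam : seq nat) (i : nat) :
  reshape_offset lam i.+1 =
  if reshape_index lam i == reshape_index lam i.+1
  then (reshape_offset lam i).+1 else 0%N.
Proof.
elim: lam i => [|a lam IH] i; first by rewrite /reshape_offset !subn0.
rewrite !reshape_index_cons !reshape_offset_cons.
have [lt_ia | le_ai] := ltnP i a; last first.
  by rewrite ltnNge (leqW le_ai) /= eqSS subSn.
have [// | le_aSi] := ltnP i.+1 a.
by rewrite (_ : i.+1 - a = 0)%N ?reshape_offset0 //; lia.
Qed.

Lemma reshape_offset_gt0 (lam : seq nat) (i : nat) :
    (0 < reshape_offset lam i)%N ->
  exists2 j, i = j.+1 & reshape_offset lam i = (reshape_offset lam j).+1.
Proof.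
case: i => [|j]; first by rewrite reshape_offset0.
by rewrite reshape_offsetS; case: ifP => // _ _; exists j.
Qed.

Lemma reshape_offset_sub (lam : seq nat) (i s : nat) :
    (s <= reshape_offset lam i)%N ->
  reshape_offset lam (i - s) = (reshape_offset lam i - s)%N.
Proof.
elim: s => [|s IH] le_s; first by rewrite !subn0.
have {IH} IH := IH (ltnW le_s).
have [|j Dis offis] := @reshape_offset_gt0 lam (i - s); first by rewrite IH; lia.
rewrite (_ : i - s.+1 = j)%N; lia.
Qed.

Lemma reshape_offset_mod (m : nat) (lam : seq nat) (i : nat) :
  all (dvdn m) lam -> reshape_offset lam i = i %[mod m].
Proof.
move=> dv_m; rewrite -{2}(reshape_indexK lam i) /flatten_index -modnDml.
suff /eqP -> : (m %| sumn (take (reshape_index lam i) lam))%N by rewrite add0n.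
by rewrite sumnE big_seq dvdn_sum // => a /mem_take /(allP dv_m).
Qed.

(** Each part [a] contributes the offsets [0, ..., a.-1], so the number of
indices of offset [j] is a part of the conjugate partition. *)
Lemma count_reshape_offset (lam : seq nat) (j : nat) :
  count (fun i => reshape_offset lam i == j) (iota 0 (sumn lam)) =
  count (fun a => (j < a)%N) lam.
Proof.
elim: lam => //= a lam IH; rewrite iotaD count_cat add0n; congr addn.
  transitivity (count (pred1 j) (iota 0 a)).
    apply: eq_in_count => i; rewrite mem_iota add0n => /= lt_ia.
    by rewrite reshape_offset_cons lt_ia.
  by rewrite count_uniq_mem ?iota_uniq // mem_iota.
rewrite -IH -[X in iota X _]addn0 iotaDl count_map; apply: eq_count => i /=.
by rewrite reshape_offset_cons ltnNge leq_addr /= addKn.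
Qed.

Lemma is_partition_sumn (n : nat) (lam : seq nat) :
  is_partition n lam -> sumn lam = n.
Proof. by case/and3P=> _ _ /eqP. Qed.

Lemma partition_eq (n : nat) (lam mu : seq nat) :
    is_partition n lam -> is_partition n mu ->
    (forall j, count (fun a => (j < a)%N) lam =
               count (fun a => (j < a)%N) mu) ->
  lam = mu.
Proof.
move=> /and3P[sl pl _] /and3P[sm pm _] eq_count_gt.
apply: (sorted_eq _ _ sl sm) => [x y z /= ? ?|x y /= ?|]; [lia | lia |].
(* The counts are the parts of the conjugate partition; their successive
   differences are the multiplicities of the parts. *)
have count_gtS (s : seq nat) j :
    (count_mem j.+1 s + count (fun a => (j.+1 < a)%N) s =
     count (fun a => (j < a)%N) s)%N.
  elim: s => //= a s <-; rewrite addnACA; congr addn.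
  by case: (ltngtP a j.+1); lia.
rewrite /perm_eq; apply/allP => -[|j] _ /=; last first.
  have := count_gtS lam j.
  by rewrite !eq_count_gt -(count_gtS mu j) => /addIn ->.
have count0 s : all (leq 1) s -> count_mem 0%N s = 0%N.
  by move=> /allP s_gt0; apply/count_memPn/negP => /s_gt0.
by rewrite !count0.
Qed.

Lemma dvdn_part_gcd (lam : seq nat) : all (dvdn (part_gcd lam)) lam.
Proof.
rewrite /part_gcd; elim: lam => //= a lam IH; rewrite big_cons dvdn_gcdl /=.
by apply: sub_all IH => b; apply: dvdn_trans; rewrite dvdn_gcdr.
Qed.

Lemma part_gcd_gt0 (n : nat) (lam : seq nat) :
  (0 < n)%N -> is_partition n lam -> (0 < part_gcd lam)%N.
Proof.
move=> n_gt0 plam; have Dn := is_partition_sumn plam.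
have := dvdn_part_gcd lam; rewrite lt0n; apply: contraTneq => ->.
case: lam plam Dn => [_ /esym Dn|[|a] lam];
  [by rewrite Dn in n_gt0 | by case/and3P | by []].
Qed.

(** * Intertwiners of Jordan matrices *)

(** The offset is zero exactly at the start of a block, so a positive offset
at [y] says that [y.-1] and [y] lie in the same block. *)
Lemma JmxE (F : fieldType) (n : nat) (lam : seq nat) (x y : 'I_n) :
  Jmx F n lam x y = ((y == x.+1 :> nat) && (0 < reshape_offset lam y)%N)%:R.
Proof.
rewrite mxE; case: eqP => //= ->; rewrite reshape_offsetS.
by case: eqP.
Qed.

Lemma mulJmx (F : fieldType) (n : nat) (lam : seq nat) (Z : 'M[F]_n)
    (x x' y : 'I_n) :
    x' = x.+1 :> nat -> (0 < reshape_offset lam x')%N ->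
  (Jmx F n lam *m Z) x y = Z x' y.
Proof.
move=> Dx x'_gt0; rewrite mxE (bigD1 x') //= big1 ?addr0 => [|z ne_zx'].
  by rewrite JmxE Dx eqxx -Dx x'_gt0 mul1r.
by rewrite JmxE -Dx (negPf (ne_zx' : (z != x' :> nat))) mul0r.
Qed.

Lemma mulmxJ (F : fieldType) (n : nat) (lam : seq nat) (Z : 'M[F]_n)
    (x y y' : 'I_n) :
    y' = y.+1 :> nat -> (0 < reshape_offset lam y')%N ->
  (Z *m Jmx F n lam) x y' = Z x y.
Proof.
move=> Dy y'_gt0; rewrite mxE (bigD1 y) //= big1 ?addr0 => [|z ne_zy].
  by rewrite JmxE Dy eqxx -Dy y'_gt0 mulr1.
by rewrite JmxE Dy eqSS eq_sym (negPf (ne_zy : (z != y :> nat))) mulr0.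
Qed.

Lemma mulmxJ0 (F : fieldType) (n : nat) (lam : seq nat) (Z : 'M[F]_n)
    (x y : 'I_n) :
  reshape_offset lam y = 0%N -> (Z *m Jmx F n lam) x y = 0.
Proof.
by move=> y0; rewrite mxE big1 // => z _; rewrite JmxE y0 andbF mulr0.
Qed.

(** Reading the relation entrywise moves [(x, y)] to [(x - 1, y - 1)] without
changing the entry; as [y] has the smaller offset, it reaches the start of its
block first, and there the column of [Z *m J] vanishes. *)
Lemma intertwiner_triangular (F : fieldType) (n : nat) (lam mu : seq nat)
    (Z : 'M[F]_n) (x y : 'I_n) :
    Jmx F n lam *m Z = Z *m Jmx F n mu ->
    (reshape_offset mu y < reshape_offset lam x)%N ->
  Z x y = 0.
Proof.
move=> twine; have [r] := ubnP (reshape_offset mu y).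
elim: r x y => // r IH x' y' le_y'r lt_y'x'.
have x'_gt0 := leq_ltn_trans (leq0n _) lt_y'x'.
have [i Dx' offx'] := reshape_offset_gt0 x'_gt0.
have lt_in : (i < n)%N by have := ltn_ord x'; lia.
rewrite -(mulJmx (lam := lam) Z (x := Ordinal lt_in)) // twine.
have [y'0 | y'_gt0] := posnP (reshape_offset mu y').
  by rewrite mulmxJ0.
have [j Dy' offy'] := reshape_offset_gt0 y'_gt0.
have lt_jn : (j < n)%N by have := ltn_ord y'; lia.
by rewrite (mulmxJ (lam := mu) Z _ (y := Ordinal lt_jn)) // IH //=; lia.
Qed.

Lemma intertwiner_toeplitz (F : fieldType) (n : nat) (lam mu : seq nat)
    (Z : 'M[F]_n) (s : nat) (x y x' y' : 'I_n) :
    Jmx F n lam *m Z = Z *m Jmx F n mu ->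
    (s <= reshape_offset lam x')%N -> (s <= reshape_offset mu y')%N ->
    x = (x' - s)%N :> nat -> y = (y' - s)%N :> nat ->
  Z x' y' = Z x y.
Proof.
move=> twine.
elim: s x y x' y' => [|s IH] x y x' y' le_sx le_sy.
  by rewrite !subn0 => Dx Dy; congr (Z _ _); apply: val_inj.
have [i Dx' offx'] := reshape_offset_gt0 (leq_ltn_trans (leq0n _) le_sx).
have [j Dy' offy'] := reshape_offset_gt0 (leq_ltn_trans (leq0n _) le_sy).
rewrite Dx' Dy' !subSS => Dx Dy.
have lt_in : (i < n)%N by have := ltn_ord x'; lia.
have lt_jn : (j < n)%N by have := ltn_ord y'; lia.
rewrite -(mulJmx (lam := lam) Z (x := Ordinal lt_in)) ?offx' //.
rewrite twine (mulmxJ (lam := mu) Z _ (y := Ordinal lt_jn)) ?offy' //.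
by apply: IH => //=; lia.
Qed.

(** * Determinants of graded and block matrices *)

Lemma det_neq0_perm (F : fieldType) (n : nat) (Z : 'M[F]_n) :
  \det Z != 0 -> exists s : 'S_n, forall x, Z x (s x) != 0.
Proof.
move=> nzZ; apply: contrapT => no_s; case/eqP: nzZ.
rewrite /determinant big1 // => s _.
have [x] : exists x, Z x (s x) = 0.
  apply: contrapT => nzs; apply: no_s; exists s => x; apply/eqP => Zx0.
  by apply: nzs; exists x.
by move=> Zx0; rewrite (bigD1 x) //= Zx0 mul0r mulr0.
Qed.

Lemma perm_nondecreasing_eq (T : finType) (f g : T -> nat) (s : {perm T}) :
    (forall x, f x <= g (s x))%N -> (\sum_x g x <= \sum_x f x)%N ->
  forall x, f x = g (s x).
Proof.
move=> le_fg; rewrite (reindex_inj (@perm_inj _ s)) /= => le_sum x.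
have := leqif_sum (fun x (_ : predT x) => leqif_eq (le_fg x)).
move=> [le_fg' /esym]; rewrite eqn_leq le_fg' le_sum => /forallP /(_ x).
by move=> /implyP /(_ isT)/eqP.
Qed.

(** A permutation contributing to the Leibniz expansion can only raise [r];
since it preserves the total of [r], it preserves [r]. *)
Lemma det_graded (R : comNzRingType) (n : nat) (r : 'I_n -> nat) (Z : 'M[R]_n) :
    (forall x y, (r y < r x)%N -> Z x y = 0) ->
  \det Z = \det (\matrix_(x, y) (if r x == r y then Z x y else 0)).
Proof.
move=> triZ; apply: eq_bigr => s _; congr (_ * _).
have [le_rs | ] := boolP [forall x, r x <= r (s x)]%N.
  apply: eq_bigr => x _; rewrite mxE ifT //.
  by apply/eqP/perm_nondecreasing_eq => //; apply/forallP.
case/forallPn => x; rewrite -ltnNge => lt_rs.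
rewrite (bigD1 x) //= triZ // mul0r (bigD1 x) //= mxE.
by rewrite eq_sym ltn_eqF // mul0r.
Qed.

(** A function [b] on [nat] instead of a matrix avoids casts between ordinals
when a copy of the block is split off. *)
Lemma det_blockdiag_repeat (R : comNzRingType) (b : nat -> nat -> R)
    (m N : nat) :
  \det (\matrix_(x < m * N, y < m * N)
          (if (x %/ N == y %/ N)%N then b (x %% N)%N (y %% N)%N else 0)) =
  \det (\matrix_(i < N, j < N) b i j) ^+ m.
Proof.
elim: m => [|m IH]; first by rewrite expr0 det_mx00.
rewrite exprS -IH -(det_lblock _ 0); congr (\det _).
apply/matrixP=> x y; rewrite mxE.
have modl (i : 'I_N) : ((i %% N) = i)%N by rewrite modn_small.
have divl (i : 'I_N) : ((i %/ N) = 0)%N by rewrite divn_small.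
case: (split_ordP (x : 'I_(N + m * N))) => i ->;
  case: (split_ordP (y : 'I_(N + m * N))) => j ->.
- by rewrite block_mxEul mxE /= !divl !modl.
- by rewrite block_mxEur mxE /= divl divnDl ?divnn ?modnn //
    (leq_ltn_trans _ (ltn_ord i)).
- by rewrite block_mxEdl mxE /= divl divnDl ?divnn ?modnn //
    (leq_ltn_trans _ (ltn_ord j)).
- have N_gt0 : (0 < N)%N
    by have := leq_ltn_trans (leq0n _) (ltn_ord i); rewrite muln_gt0 => /andP[].
  by rewrite block_mxEdr mxE /= !divnDl ?dvdnn // divnn N_gt0 eqSS !modnDl.
Qed.

Lemma det_reindex (R : comNzRingType) (n p : nat) (f : 'I_n -> 'I_p)
    (A : 'M[R]_p) :
  n = p -> injective f -> \det (\matrix_(i < n, j < n) A (f i) (f j)) = \det A.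
Proof.
move=> eq_np; case: _ / eq_np in f A * => inj_f.
pose s := perm inj_f.
rewrite (_ : \matrix_(i, j) _ = row_perm s (col_perm s A)); last first.
  by apply/matrixP=> i j; rewrite !mxE !permE.
rewrite row_permE col_permE !det_mulmx !det_perm.
by rewrite odd_permV mulrCA -signr_addb addbb mulr1.
Qed.

(** * Determinants of the centralizer *)

(** The degree 0 part of [Z] is, up to a reordering of the basis, block diagonal
with [m] equal blocks, one for each residue of the offset modulo [m]. *)
Lemma det_centralizer_is_power (F : fieldType) (n : nat) (lam : seq nat) (m : nat)
    (Z : 'M[F]_n) :
    (0 < m)%N -> sumn lam = n -> all (dvdn m) lam ->
    Jmx F n lam *m Z = Z *m Jmx F n lam ->
  exists c, \det Z = c ^+ m.
Proof.
move=> m_gt0 Dn dv_mlam comJZ; pose N := (n %/ m)%N.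
have dv_mn : (m %| n)%N.
  by rewrite -Dn sumnE big_seq dvdn_sum // => a /(allP dv_mlam).
have DmN : n = (m * N)%N by rewrite mulnC divnK.
(* The head of x is the row at which its length-m segment starts; no segment
   straddles two Jordan blocks. *)
pose off (x : 'I_n) := reshape_offset lam x.
have head_ltn (x : 'I_n) : (m * (x %/ m) < n)%N.
  by rewrite mulnC (leq_ltn_trans (leq_divM _ _)).
pose head x := Ordinal (head_ltn x).
have off_mod (x : 'I_n) : (off x %% m = x %% m)%N by apply: reshape_offset_mod.
have off_ge (x : 'I_n) : (x %% m <= off x)%N by rewrite -off_mod leq_mod.
have headE (x : 'I_n) : head x = (x - x %% m)%N :> nat.
  by rewrite /= {2}(divn_eq x m) addnK mulnC.
have off_head (x : 'I_n) : off x = (off (head x) + x %% m)%N.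
  by rewrite /off headE reshape_offset_sub ?subnK ?off_ge.
(* b is read off at the heads of two segments; insub always succeeds below, as
   m * i and m * j are less than n. *)
pose b i j : F := if insub (m * i)%N : option 'I_n is Some x then
                    if insub (m * j)%N : option 'I_n is Some y then
                      if off x == off y then Z x y else 0 else 0 else 0.
exists (\det (\matrix_(i < N, j < N) b i j)).
rewrite (@det_graded _ _ off); last by move=> x y; apply: intertwiner_triangular.
rewrite -det_blockdiag_repeat.
(* Listing rows by residue modulo m first makes the graded part of Z block
   diagonal with m copies of b. *)
have swap_ltn (x : 'I_n) : (x %% m * N + x %/ m < m * N)%N.
  have lt_xN : (x %/ m < N)%N by rewrite ltn_divLR // divnK.
  have : ((x %% m).+1 * N <= m * N)%N by rewrite leq_mul2r ltn_pmod // orbT.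
  by rewrite mulSn; lia.
pose swap x := Ordinal (swap_ltn x).
have divN (x : 'I_n) : ((x %% m * N + x %/ m) %/ N = x %% m)%N.
  have lt_xN : (x %/ m < N)%N by rewrite ltn_divLR // divnK.
  by rewrite divnMDl ?(leq_ltn_trans _ lt_xN) // divn_small ?addn0.
have modN (x : 'I_n) : ((x %% m * N + x %/ m) %% N = x %/ m)%N.
  have lt_xN : (x %/ m < N)%N by rewrite ltn_divLR // divnK.
  by rewrite modnMDl modn_small.
have inj_swap : injective swap.
  move=> x y /(congr1 val) /= eq_xy; apply: val_inj => /=.
  have eq_mod : (x %% m = y %% m)%N by rewrite -divN eq_xy divN.
  have eq_div : (x %/ m = y %/ m)%N by rewrite -modN eq_xy modN.
  by rewrite (divn_eq x m) eq_mod eq_div -divn_eq.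
rewrite -(det_reindex (f := swap)) //; congr (\det _).
apply/matrixP=> x y; rewrite !mxE /= !divN !modN.
rewrite /b !insubT //= => ? ?.
set x0 := Sub _ _; set y0 := Sub _ _.
have -> : x0 = head x by apply: val_inj.
have -> : y0 = head y by apply: val_inj.
rewrite off_head (off_head y).
have [eq_xy | ne_xy] := eqVneq (x %% m)%N (y %% m)%N.
  rewrite eq_xy eqn_add2r; case: eqP => // _.
  apply: (intertwiner_toeplitz (s := (y %% m)%N) comJZ).
  - by rewrite -eq_xy; apply: off_ge.
  - exact: off_ge.
  - by rewrite -eq_xy headE.
  - exact: headE.
case: eqP => // eq_off; case/eqP: ne_xy.
by rewrite -!off_mod off_head (off_head y) eq_off.
Qed.

Lemma prod_reshape_index (F : fieldType) (lam : seq nat) (c : F) :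
    c != 0 ->
  exists f : nat -> F,
    \prod_(0 <= i < sumn lam) f (reshape_index lam i) = c ^+ part_gcd lam.
Proof.
elim: lam c => [|a lam IH] c nzc.
  by exists (fun=> 1); rewrite /part_gcd big_nil big_geq.
have [p [q Dgcd]] := Bezoutz a%:Z (part_gcd lam)%:Z.
have [f fE] := IH (c ^ q) (expfz_neq0 _ nzc).
(* Here p * a + q * part_gcd lam is the new gcd: weight c ^ p on the first
   block, and the weights for c ^ q on the others. *)
exists (fun i => if i is j.+1 then f j else c ^ p).
rewrite /= (big_cat_nat (n := a)) ?leq_addr //=.
rewrite (eq_big_nat _ _ (F2 := fun=> c ^ p)) => [|i /andP[_ lt_ia]]; last first.
  by rewrite reshape_index_cons lt_ia.
rewrite prodr_const_nat subn0 -{2}[a]add0n big_addn addKn.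
rewrite (eq_bigr (fun i => f (reshape_index lam i))) => [|i _]; last first.
  by rewrite reshape_index_cons ltnNge leq_addl addnK.
by rewrite fE !exprnP !exprz_exp -expfzDr // Dgcd /part_gcd big_cons.
Qed.

(** The witness is a scalar on each Jordan block. *)
Lemma exists_centralizer_det (F : fieldType) (n : nat) (lam : seq nat) (c : F) :
    sumn lam = n -> c != 0 ->
  exists2 Z, Jmx F n lam *m Z = Z *m Jmx F n lam & \det Z = c ^+ part_gcd lam.
Proof.
move=> Dn nzc; have [f fE] := prod_reshape_index lam nzc.
exists (diag_mx (\row_(i < n) f (reshape_index lam i))).
  rewrite mul_mx_diag mul_diag_mx; apply/matrixP=> x y; rewrite !mxE mulrC.
  by case: andP => [[_ /eqP ->] | _]; rewrite ?mulr0 ?mul0r.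
by rewrite det_diag -fE Dn big_mkord; apply: eq_bigr => i _; rewrite mxE.
Qed.

Lemma Jmx_twine_inj (F : fieldType) (n : nat) (lam mu : seq nat) (Z : 'M[F]_n) :
    is_partition n lam -> is_partition n mu -> Z \in unitmx ->
    Jmx F n lam *m Z = Z *m Jmx F n mu ->
  lam = mu.
Proof.
move=> plam pmu uZ twine; apply: (partition_eq plam pmu).
have le_off (la nu : seq nat) (G : 'M[F]_n) :
    G \in unitmx -> Jmx F n la *m G = G *m Jmx F n nu ->
  exists s : 'S_n,
    forall x : 'I_n, (reshape_offset la x <= reshape_offset nu (s x))%N.
  move=> uG twG; have [|s nzG] := @det_neq0_perm _ _ G; first by rewrite -unitfE.
  exists s => x; rewrite leqNgt; apply: contra (nzG x) => lt_off.
  by rewrite (intertwiner_triangular twG).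
(* Offsets increase along a permutation in both directions, so they agree. *)
have [s le_lm] := le_off lam mu Z uZ twine.
have [||t le_ml] := le_off mu lam (invmx Z); first by rewrite unitmx_inv.
  by rewrite -[LHS](mulKmx uZ) (mulmxA Z) -twine mulmxK.
have sum_le : (\sum_(x < n) reshape_offset mu x <=
               \sum_(x < n) reshape_offset lam x)%N.
  by rewrite [leqRHS](reindex_inj (@perm_inj _ t)); apply: leq_sum.
have eq_off := perm_nondecreasing_eq le_lm sum_le.
move=> j; rewrite -!count_reshape_offset.
rewrite (is_partition_sumn plam) (is_partition_sumn pmu).
have countE la : count (fun i => reshape_offset la i == j) (iota 0 n) =
    (\sum_(x < n) (reshape_offset la x == j))%N.
  by rewrite -sum1_count big_mkcond -[in iota 0 n](subn0 n) big_mkord.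
rewrite !countE [RHS](reindex_inj (@perm_inj _ s)) /=.
by apply: eq_bigr => x _; rewrite eq_off.
Qed.

(** * Descent of intertwiners to an infinite subfield *)

Lemma valuation_injective (k : fieldType) (v : k -> int) (x : k) :
    (forall y z, y != 0 -> z != 0 -> v (y * z) = v y + v z) ->
    x != 0 -> v x = 1 ->
  injective (fun i => x ^+ i).
Proof.
move=> vM nzx vx; have v1 : v 1 = 0.
  by apply: (addrI (v 1)); rewrite -vM ?oner_neq0 // mulr1 addr0.
have vX i : v (x ^+ i) = i%:Z.
  elim: i => [|i IH]; first by rewrite expr0.
  by rewrite exprS vM ?expf_neq0 // vx IH -PoszD add1n.
by move=> i j /(congr1 v); rewrite !vX => -[].
Qed.

Section Descent.
(* The injection u witnesses that k is infinite. *)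
Variables (k K : fieldType) (f : {rmorphism k -> K}).
Variables (u : nat -> k) (inj_u : injective u).

Lemma poly_nonroot (p : {poly K}) : p != 0 -> exists x, ~~ root p (f x).
Proof.
move=> nzp; apply: contrapT => no_x.
have := @max_poly_roots _ p [seq f (u i) | i <- iota 0 (size p)] nzp.
rewrite size_map size_iota ltnn map_inj_uniq ?iota_uniq;
  last by move=> i j /fmorph_inj/inj_u.
move=> absurd; suff: false by []; apply: absurd => //.
apply/allP => y /mapP[i _ ->]; apply/negPn/negP => nroot.
by apply: no_x; exists (u i).
Qed.

Lemma det_pencil_nonzero (n : nat) (A B : 'M[K]_n) (t : K) :
  \det (A + t *: B) != 0 -> exists x, \det (A + f x *: B) != 0.
Proof.
pose p := \det (map_mx polyC A + 'X *: map_mx polyC B).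
have pE s : p.[s] = \det (A + s *: B).
  rewrite -[LHS]/(horner_eval s p) -det_map_mx; congr (\det _).
  by apply/matrixP=> i j; rewrite !mxE /= /horner_eval !hornerE.
rewrite -pE => nz_pt; have [|x] := @poly_nonroot p.
  by apply: contraNneq nz_pt => ->; rewrite horner0.
by rewrite /root pE => ?; exists x.
Qed.

(** A polynomial in several variables that does not vanish on [K ^ N] does not
vanish on [k ^ N]; the coordinates are moved into [k] one at a time, so only
polynomials in one variable occur. *)
Lemma det_affine_descent (N n : nat) (A : 'M[K]_n) (B : 'I_N -> 'M[K]_n)
    (c : 'I_N -> K) :
    \det (A + \sum_i c i *: B i) != 0 ->
  exists d : 'I_N -> k, \det (A + \sum_i f (d i) *: B i) != 0.
Proof.
elim: N A B c => [|N IH] A B c.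
  by rewrite big_ord0 => ?; exists (fun=> 0); rewrite big_ord0.
(* The first coefficient moves into k while the others stay in the constant
   term; its term then joins that constant. *)
rewrite big_ord_recl addrCA addrC => /det_pencil_nonzero[x].
rewrite addrAC => /IH[d nz_d].
exists (fun i => if unlift ord0 i is Some j then d j else x).
rewrite big_ord_recl unlift_none addrA.
by under eq_bigr do rewrite liftK.
Qed.

(** An invertible solution over [K] is a combination of finitely many solutions over
[k]; the determinant of such a combination is a polynomial in its coefficients,
and it does not vanish identically. *)
Lemma intertwiner_descent (n : nat) (X Y : 'M[k]_n) (g : 'M[K]_n) :
    map_mx f X *m g = g *m map_mx f Y -> \det g != 0 ->
  exists2 h : 'M[k]_n, X *m h = h *m Y & \det h != 0.
Proof.
move=> twine nz_g.
pose L (F : fieldType) (P Q : 'M[F]_n) := (mulmx P \- mulmxr Q) : 'M_n -> 'M_n.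
(* The rows of M span the solutions h of X *m h = h *m Y; kernels commute with
   extension of scalars, so they also span the solutions over K. *)
pose M := kermx (lin_mx (L k X Y)).
have kerM (F : fieldType) (P Q G : 'M[F]_n) :
  (mxvec G <= kermx (lin_mx (L F P Q)))%MS = (P *m G == G *m Q).
  by rewrite sub_kermx mul_vec_lin /= mxvec_eq0 subr_eq0.
have : (mxvec g <= map_mx f M)%MS.
  rewrite map_kermx (map_lin_mx (gf := L K (map_mx f X) (map_mx f Y))).
    by rewrite kerM twine.
  by move=> G; rewrite /L /= map_mxB !map_mxM.
case/submxP=> c Dg.
have DgS : g = \sum_i c 0 i *: map_mx f (vec_mx (row i M)).
  rewrite -[g]mxvecK Dg mulmx_sum_row linear_sum; apply: eq_bigr => i _.
  by rewrite linearZ /= -map_row map_vec_mx.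
move: nz_g; rewrite {1}DgS -[X in \det X]add0r => /det_affine_descent[d].
rewrite add0r.
pose h := \sum_i d i *: vec_mx (row i M).
rewrite (_ : \sum_i _ = map_mx f h) => [|].
  rewrite det_map_mx fmorph_eq0 => nz_h; exists h => //.
  apply/eqP; rewrite -kerM linear_sum summx_sub // => i _.
  by rewrite linearZ scalemx_sub //= vec_mxK row_sub.
by rewrite raddf_sum; apply: eq_bigr => i _; rewrite /= map_mxZ.
Qed.

End Descent.

(** * Orbits under the special linear group *)

Lemma SLorbitP (F : fieldType) (n : nat) (X Y : 'M[F]_n) :
  SLorbit X Y <-> exists2 g, \det g = 1 & Y *m g = g *m X.
Proof.
split=> -[g g1 DY]; exists g => //; have ug : g \in unitmx.
- by rewrite unitmxE (g1 : \det g = 1) unitr1.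
- by rewrite DY mulmxKV.
- by rewrite unitmxE g1 unitr1.
- by rewrite -DY mulmxK.
Qed.

Lemma SLorbit_refl (F : fieldType) (n : nat) (X : 'M[F]_n) : SLorbit X X.
Proof. by apply/SLorbitP; exists 1%:M; rewrite ?det1 // mulmx1 mul1mx. Qed.

Lemma SLorbit_sym (F : fieldType) (n : nat) (X Y : 'M[F]_n) :
  SLorbit X Y -> SLorbit Y X.
Proof.
move=> /SLorbitP[g det_g Yg].
have ug : g \in unitmx by rewrite unitmxE det_g unitr1.
apply/SLorbitP; exists (invmx g); first by rewrite det_inv det_g invr1.
by rewrite -[LHS](mulKmx ug) (mulmxA g) -Yg mulmxK.
Qed.

Lemma SLorbit_sub (F : fieldType) (n : nat) (X Y : 'M[F]_n) :
  SLorbit X Y -> SLorbit Y `<=` SLorbit X.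
Proof.
move=> /SLorbitP[g det_g Yg] W /SLorbitP[h det_h Wh].
apply/SLorbitP; exists (h *m g); first by rewrite det_mulmx det_g det_h mulr1.
by rewrite mulmxA Wh -!mulmxA Yg.
Qed.

Lemma SLorbit_eq (F : fieldType) (n : nat) (X Y : 'M[F]_n) :
  SLorbit X Y -> SLorbit X = SLorbit Y.
Proof.
by move=> XY; apply/seteqP; split; apply: SLorbit_sub => //; apply: SLorbit_sym.
Qed.

Lemma mxtrace_twine (F : fieldType) (n : nat) (X Y h : 'M[F]_n) :
  h \in unitmx -> X *m h = h *m Y -> \tr X = \tr Y.
Proof. by move=> uh Xh; rewrite -(mulmxK uh X) Xh mxtrace_mulC mulKmx. Qed.

(** * Classes modulo powers *)

Lemma power_class_refl (k : fieldType) (m : nat) (d : k) : power_class m d d.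
Proof. by exists 1; rewrite ?oner_neq0 // expr1n mulr1. Qed.

Lemma power_class_sym (k : fieldType) (m : nat) (d e : k) :
  power_class m d e -> power_class m e d.
Proof.
move=> [c nzc ->]; exists c^-1; first exact: invr_neq0.
by rewrite exprVn mulfK ?expf_neq0.
Qed.

Lemma power_class_sub (k : fieldType) (m : nat) (d e : k) :
  power_class m d e -> power_class m e `<=` power_class m d.
Proof.
move=> [c nzc ->] _ [b nzb ->]; exists (c * b); first exact: mulf_neq0.
by rewrite exprMn mulrA.
Qed.

Lemma power_class_eqP (k : fieldType) (m : nat) (d e : k) :
  power_class m d = power_class m e <-> power_class m d e.
Proof.
split=> [->|de]; first exact: power_class_refl.
by apply/seteqP; split; apply: power_class_sub => //; apply: power_class_sym.
Qed.

(** * The representatives J D(d) *)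

Section Representatives.
Variables (F : fieldType) (n : nat) (n_gt0 : (0 < n)%N) (lam : seq nat).
Notation J := (Jmx F n lam).
Notation D := (Dmx F n).

Lemma det_Dmx (d : F) : \det (D d) = d.
Proof.
case: n n_gt0 => // N _; rewrite det_diag big_ord_recr /= mxE eqxx.
rewrite big1 ?mul1r // => i _; rewrite mxE /= ifN //.
by rewrite eqSS ltn_eqF.
Qed.

Lemma mul_Dmx_Jmx (d : F) : D d *m J = J.
Proof.
apply/matrixP=> x y; rewrite mul_diag_mx !mxE.
case: eqP => [Dn | _]; last by rewrite mul1r.
by case: eqP => [Dy | _]; rewrite ?mulr0 //;
  have := ltn_ord y; rewrite Dy Dn ltnn.
Qed.

Lemma mxtrace_Jmx : \tr J = 0.
Proof. by rewrite /mxtrace big1 // => i _; rewrite mxE ltn_eqF. Qed.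

(** [J D(d) = D(d)^-1 J D(d)], so [g] conjugates [J D(d)] to [X] exactly when
[g D(d)^-1] conjugates [J] to [X]. *)
Lemma SLorbit_JDP (d : F) (X : 'M[F]_n) : d != 0 ->
  SLorbit (J *m D d) X <-> exists2 h, \det h = d^-1 & X *m h = h *m J.
Proof.
move=> nzd; rewrite SLorbitP.
have uD : D d \in unitmx by rewrite unitmxE det_Dmx unitfE.
split=> -[g det_g DX].
  exists (g *m invmx (D d));
    first by rewrite det_mulmx det_inv det_Dmx det_g mul1r.
  by rewrite mulmxA DX -!mulmxA mulmxV // mulmx1 -{2}(mul_Dmx_Jmx d) mulKmx.
exists (g *m D d); first by rewrite det_mulmx det_Dmx det_g mulVf.
by rewrite mulmxA DX -!mulmxA [D d *m (J *m _)]mulmxA mul_Dmx_Jmx.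
Qed.

Lemma SLorbit_JD_power_sub (d d' : F) : d != 0 -> d' != 0 ->
    power_class (part_gcd lam) d d' -> sumn lam = n ->
  SLorbit (J *m D d) `<=` SLorbit (J *m D d').
Proof.
move=> nzd nzd' [c nzc Dd'] Dn X /(SLorbit_JDP _ nzd)[h det_h DX].
have [Z comJZ det_Z] := exists_centralizer_det Dn (invr_neq0 nzc).
apply/SLorbit_JDP => //; exists (h *m Z).
  by rewrite det_mulmx det_h det_Z exprVn Dd' invfM.
by rewrite mulmxA DX -!mulmxA comJZ.
Qed.

End Representatives.

Lemma SLorbit_JD_eqP (F : fieldType) (n : nat) (lam mu : seq nat) (d e : F) :
    (0 < n)%N -> is_partition n lam -> is_partition n mu ->
    d != 0 -> e != 0 ->
  SLorbit (Jmx F n lam *m Dmx F n d) = SLorbit (Jmx F n mu *m Dmx F n e) <->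
  lam = mu /\ power_class (part_gcd lam) d e.
Proof.
move=> n_gt0 plam pmu nzd nze; split=> [eq_orb | [<- de]]; last first.
  have Dn := is_partition_sumn plam.
  apply/seteqP; split; apply: SLorbit_JD_power_sub => //.
  exact: power_class_sym.
have orb := SLorbit_refl (Jmx F n lam *m Dmx F n d).
have : SLorbit (Jmx F n mu *m Dmx F n e) (Jmx F n lam *m Dmx F n d).
  by rewrite -eq_orb.
move/(SLorbit_JDP n_gt0 _ _ nze) => [h' det_h' Xh'].
move/(SLorbit_JDP n_gt0 _ _ nzd): orb => [h det_h Xh].
have uh : h \in unitmx by rewrite unitmxE det_h unitrV unitfE.
have uh' : h' \in unitmx by rewrite unitmxE det_h' unitrV unitfE.
(* The intertwiner is invertible with determinant d / e. *)
have twine : Jmx F n lam *m (invmx h *m h') = (invmx h *m h') *m Jmx F n mu.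
  by rewrite -[LHS](mulKmx uh) (mulmxA h) -Xh -(mulmxA _ h) mulKVmx //
    Xh' mulmxA.
have eq_lm : lam = mu.
  by apply: (Jmx_twine_inj plam pmu _ twine); rewrite unitmx_mul unitmx_inv uh.
split=> //; rewrite -{mu}eq_lm in twine pmu {eq_orb Xh'}.
have Dn := is_partition_sumn plam.
have [c det_c] := det_centralizer_is_power (part_gcd_gt0 n_gt0 plam) Dn
  (dvdn_part_gcd lam) twine.
apply: power_class_sym.
have det_cE : c ^+ part_gcd lam = d / e.
  by rewrite -det_c det_mulmx det_inv det_h det_h' invrK.
exists c; last by rewrite det_cE mulrCA divff ?mulr1.
apply: contraNneq nzd => c0; move: det_cE.
rewrite c0 expr0n gtn_eqF ?(part_gcd_gt0 n_gt0 plam) // => /esym/eqP.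
by rewrite mulf_eq0 invr_eq0 (negPf nze) orbF.
Qed.

(** * Rational points of the nilpotent orbit *)

Lemma exists_root (K : closedFieldType) (n : nat) (a : K) :
  (0 < n)%N -> exists z, z ^+ n = a.
Proof.
move=> n_gt0.
have [z zE] := solve_monicpoly (fun i => if i == 0%N then a else 0) n_gt0.
exists z; rewrite zE; case: n n_gt0 {zE} => // n _.
by rewrite big_ord_recl /= expr0 mulr1 big1 ?addr0 // => i _; rewrite mul0r.
Qed.

Lemma map_Jmx (k K : fieldType) (iota : {rmorphism k -> K}) (n : nat)
    (lam : seq nat) :
  map_mx iota (Jmx k n lam) = Jmx K n lam.
Proof. by apply/matrixP=> x y; rewrite !mxE rmorph_nat. Qed.

Lemma SLorbit_JD_sub (k : fieldType) (K : closedFieldType)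
    (iota : {rmorphism k -> K}) (n : nat) (lam : seq nat) (d : k) :
    (0 < n)%N -> d != 0 ->
  SLorbit (Jmx k n lam *m Dmx k n d) `<=` nilp_orbit_pts iota n lam.
Proof.
move=> n_gt0 nzd X /(SLorbit_JDP n_gt0 _ _ nzd) [h det_h Xh].
have uh : h \in unitmx by rewrite unitmxE det_h unitrV unitfE.
split; first by rewrite /sl /= (mxtrace_twine uh Xh) mxtrace_Jmx.
have [z zn] := exists_root (iota d) n_gt0.
apply/SLorbitP; exists (z *: map_mx iota h).
  by rewrite detZ zn det_map_mx det_h fmorphV divff ?fmorph_eq0.
by rewrite -scalemxAr -scalemxAl -map_mxM Xh map_mxM map_Jmx.
Qed.

Lemma nilp_orbit_pts_JD (k : fieldType) (K : closedFieldType)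
    (iota : {rmorphism k -> K}) (n : nat) (lam : seq nat) (u : nat -> k)
    (X : 'M[k]_n) :
    injective u -> (0 < n)%N -> nilp_orbit_pts iota n lam X ->
  exists2 d, d != 0 & SLorbit (Jmx k n lam *m Dmx k n d) X.
Proof.
move=> inj_u n_gt0 [_ /SLorbitP[g det_g]]; rewrite -(map_Jmx iota) => Xg.
have [|h Xh nz_h] := intertwiner_descent inj_u Xg.
  by rewrite det_g oner_neq0.
exists (\det h)^-1; first by rewrite invr_eq0.
by apply/SLorbit_JDP; rewrite ?invr_eq0 //; exists h; rewrite ?invrK.
Qed.

Theorem proposition4p1 (k : fieldType) (K : closedFieldType)
    (iota : {rmorphism k -> K}) (n : nat)
    (hk : nonarchimedean_local_field k)
    (hK : is_algebraic_closure iota)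
    (hn : (2 <= n)%N)
    (hchar : [pchar k] =i pred0 \/
             exists2 p : nat, p \in [pchar k] & (3 * (n - 1) < p)%N)
    (lam : seq nat) (hlam : is_partition n lam) :
  [/\ (* (1) *)
      (forall d : k, d != 0 ->
         rational_orbits iota n lam (SLorbit (Jmx k n lam *m Dmx k n d)))
      /\
      (forall Om : set 'M[k]_n, rational_orbits iota n lam Om ->
         exists2 d : k, d != 0 & Om = SLorbit (Jmx k n lam *m Dmx k n d)),
      (* (2) *)
      forall (lam' : seq nat) (d d' : k),
        is_partition n lam' -> d != 0 -> d' != 0 ->
        (SLorbit (Jmx k n lam *m Dmx k n d) =
         SLorbit (Jmx k n lam' *m Dmx k n d')) <->
        (lam = lam' /\
         power_class (part_gcd lam) d = power_class (part_gcd lam) d')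
    & rational_orbits iota n lam #= power_quotient k (part_gcd lam)].
Proof.
have n_gt0 : (0 < n)%N by apply: leq_trans hn.
have [v [[vM _ [pi nz_pi v_pi]] _ _]] := hk.
have inj_pi := valuation_injective vM nz_pi v_pi.
have orbit_rat d : d != 0 ->
    rational_orbits iota n lam (SLorbit (Jmx k n lam *m Dmx k n d)).
  move=> nzd; have sub := SLorbit_JD_sub iota (lam := lam) n_gt0 nzd.
  split=> //; exists (Jmx k n lam *m Dmx k n d) => //.
  by have [] := sub _ (SLorbit_refl _).
have rat_orbit Om : rational_orbits iota n lam Om ->
    exists2 d, d != 0 & Om = SLorbit (Jmx k n lam *m Dmx k n d).
  move=> [[X _ ->] sub].
  have [d nzd dX] := nilp_orbit_pts_JD inj_pi n_gt0
    (sub _ (SLorbit_refl _)).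
  by exists d => //; rewrite (SLorbit_eq dX).
have orbit_eq mu d e : is_partition n mu -> d != 0 -> e != 0 ->
    SLorbit (Jmx k n lam *m Dmx k n d) = SLorbit (Jmx k n mu *m Dmx k n e) <->
    lam = mu /\ power_class (part_gcd lam) d = power_class (part_gcd lam) e.
  by move=> pmu nzd nze; rewrite SLorbit_JD_eqP // power_class_eqP.
split=> //; apply/card_set_bijP.
(* An orbit is sent to the set of all d that represent it: unlike a map from
   classes to orbits, this needs no choice of a representative. *)
pose cls (Om : set 'M[k]_n) : set k :=
  [set e | e != 0 /\ Om = SLorbit (Jmx k n lam *m Dmx k n e)].
have clsE d : d != 0 ->
    cls (SLorbit (Jmx k n lam *m Dmx k n d)) = power_class (part_gcd lam) d.
  move=> nzd; apply/seteqP; split=> e.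
    by move=> [nze /orbit_eq[]// _ /power_class_eqP].
  move=> de;
  have nze : e != 0 by case: de => c nzc ->; rewrite mulf_neq0 ?expf_neq0.
  by split=> //; apply/orbit_eq => //; split=> //; apply/power_class_eqP.
exists cls; split.
- by move=> _ /rat_orbit[d nzd ->]; exists d => //; rewrite clsE.
- move=> X Y /set_mem/rat_orbit[d nzd ->] /set_mem/rat_orbit[e nze ->].
  by rewrite !clsE // => eq_cls; apply/orbit_eq.
- by move=> _ [d nzd ->]; exists (SLorbit (Jmx k n lam *m Dmx k n d));
    rewrite ?clsE //; apply: orbit_rat.
Qed.
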